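(* There exist Kähler–Einstein Fano polygons which are not minimal.
   Context: Let $N\cong\mathbb{Z}^2$, $M=\mathrm{Hom}(N,\mathbb{Z})$, $N_{\mathbb{Q}}=N\otimes\mathbb{Q}$, $M_{\mathbb{Q}}=M\otimes\mathbb{Q}$. A convex lattice polygon $P\subset N_{\mathbb{Q}}$ is Fano if the origin lies in its strict interior and every vertex $(x,y)$ satisfies $\gcd(x,y)=1$. The dual of $P$ is $P^*=\{u\in M_{\mathbb{Q}} : u(x)\ge -1\ \forall x\in P\}$; a Fano polygon is Kähler–Einstein if the barycentre (centroid) of $P^*$ is the origin. Mutation: let $P$ be a Fano polygon and $w\in M$ primitive. Put $h_{\min}=\min_{x\in P}w(x)$, $h_{\max}=\max_{x\in P}w(x)$. For an integer $h$ let $N_h=\{x\in N: w(x)=h\}$, $P_h=\mathrm{conv}(P\cap N_h)$, and let $\mathcal{V}(P)_h$ be the set of vertices of $P$ lying in $N_h$. A lattice polytope $F\subset N_{\mathbb{Q}}$ is a factor of $P$ with respect to $w$ if $w(F)=\{0\}$ and for every integer $h$ with $h_{\min}\le h<0$ there is a (possibly empty) lattice polytope $R_h\subset N_{\mathbb{Q}}$ with $\mathcal{V}(P)_h\subseteq R_h+|h|F\subseteq P_h$. The mutation of $P$ with respect to $w$ and $F$ is $\mathrm{mut}_w(P,F)=\mathrm{conv}\big(\bigcup_{h=h_{\min}}^{-1}R_h\cup\bigcup_{h=0}^{h_{\max}}(P_h+hF)\big)$ (it does not depend on the choice of the $R_h$). A Fano polygon $P$ is minimal if $|\partial P\cap N|\le|\partial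 Q\cap N|$ for every mutation $Q=\mathrm{mut}_w(P,F)$ of $P$. *)

(* Defs.v *)
From mathcomp Require Import all_boot all_order all_algebra.
From mathcomp Require Import all_classical all_reals all_analysis.

Set Implicit Arguments.
Unset Strict Implicit.
Unset Printing Implicit Defensive.

Import Order.TTheory GRing.Theory Num.Theory numFieldNormedType.Exports.
Local Open Scope classical_set_scope.
Local Open Scope ring_scope.

(* N = Z^2, and M = Hom(N, Z) = Z^2 through the dual basis. *)
Definition latt := (int * int)%type.
Definition rplane := (rat^o * rat^o)%type.

Definition of_latt (z : latt) : rplane := (z.1%:~R, z.2%:~R).

Definition primitive (z : latt) : bool := coprimez z.1 z.2.

Definition pairing (u x : rplane) : rat := u.1 * x.1 + u.2 * x.2.

Definition height (w : latt) (x : rplane) : rat := pairing (of_latt w) x.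

Definition conv_hull (A : set rplane) : set rplane :=
  smallest (@convex_set rat rplane) A.

Definition lattice_polytope (P : set rplane) : Prop :=
  exists s : seq latt, P = conv_hull [set of_latt z | z in [set` s]].

Definition vertices (P : set rplane) : set rplane :=
  [set v | P v /\ forall (x y : rplane) (t : rat), P x -> P y ->
     0 < t -> t < 1 -> v = t *: x + (1 - t) *: y -> x = v /\ y = v].

(* The vertices of a lattice polytope are lattice points, so that quantifying
   over the lattice points which are vertices reaches all of them. *)
Definition fano (P : set rplane) : Prop :=
  [/\ lattice_polytope P,
      interior P (0 : rplane) &
      forall z : latt, vertices P (of_latt z) -> primitive z].

Definition dual (P : set rplane) : set rplane :=
  [set u | forall x, P x -> -1 <= pairing u x].

(* Areas and centroids only make sense over the reals: the real polygon spanned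
   by a rational one is the closure of its set of rational points. *)
Definition real_points (R : realType) (S : set rplane) : set (R * R) :=
  closure [set ((ratr u.1, ratr u.2) : R * R) | u in S].

Definition barycentre (R : realType) (S : set (R * R)) : R * R :=
  let mu := (@lebesgue_measure R \x @lebesgue_measure R)%E in
  ((\int[mu]_(x in S) x.1) / fine (mu S),
   (\int[mu]_(x in S) x.2) / fine (mu S)).

Definition kahler_einstein (R : realType) (P : set rplane) : Prop :=
  barycentre (@real_points R (dual P)) = (0, 0).

(* The minimum and the maximum of w on a nonempty lattice polytope are
   integers; otherwise these two functions take the junk value 0. *)
Definition hmin (w : latt) (P : set rplane) : int :=
  xget 0 [set h : int | (exists2 x, P x & height w x = h%:~R) /\
                        forall x, P x -> h%:~R <= height w x].

Definition hmax (w : latt) (P : set rplane) : int :=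
  xget 0 [set h : int | (exists2 x, P x & height w x = h%:~R) /\
                        forall x, P x -> height w x <= h%:~R].

Definition level (w : latt) (h : int) : set rplane :=
  [set of_latt z | z in [set z | height w (of_latt z) = h%:~R]].

Definition slice (w : latt) (P : set rplane) (h : int) : set rplane :=
  conv_hull (P `&` level w h).

Definition msum (A B : set rplane) : set rplane :=
  [set x + y | x in A & y in B].

Definition dilate (k : int) (A : set rplane) : set rplane :=
  [set (k%:~R : rat) *: x | x in A].

(* F is a factor of P with respect to w, as witnessed by the family (Rh h);
   the values of Rh outside of hmin w P <= h < 0 are irrelevant. *)
Definition factor_with (w : latt) (P F : set rplane) (Rh : int -> set rplane)
    : Prop :=
  [/\ lattice_polytope F,
      height w @` F = [set 0] &
      forall h : int, hmin w P <= h -> h < 0 ->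
        [/\ lattice_polytope (Rh h),
            vertices P `&` level w h `<=` msum (Rh h) (dilate `|h| F) &
            msum (Rh h) (dilate `|h| F) `<=` slice w P h]].

Definition mut (w : latt) (P F : set rplane) (Rh : int -> set rplane)
    : set rplane :=
  conv_hull
    ((\bigcup_(h in [set h : int | hmin w P <= h /\ h < 0]) Rh h) `|`
     (\bigcup_(h in [set h : int | 0 <= h /\ h <= hmax w P])
        msum (slice w P h) (dilate h F))).

Definition is_mutation (P Q : set rplane) : Prop :=
  exists (w : latt) (F : set rplane) (Rh : int -> set rplane),
    [/\ primitive w, factor_with w P F Rh & Q = mut w P F Rh].

Definition boundary (P : set rplane) : set rplane := closure P `\` interior P.

Definition boundary_points (P : set rplane) : set latt :=
  [set z | boundary P (of_latt z)].

Definition minimal (P : set rplane) : Prop :=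
  forall Q : set rplane, is_mutation P Q ->
    (boundary_points P #<= boundary_points Q)%card.

(* Main.v *)
Require Import Defs.
From mathcomp Require Import all_boot all_order all_algebra.
From mathcomp Require Import all_classical all_reals all_analysis.
From mathcomp Require Import ring lra zify.

(** The proof exhibits one quadrilateral.

    Mutating a Fano polygon [P] along [w] with a segment of lattice length one
    shears one side of the boundary and leaves the other side alone; the edge of
    [P] at height [hmin] becomes shorter by [- hmin] lattice units, and the edge
    at height [hmax], which may be a vertex, becomes longer by [hmax].  The
    number of boundary lattice points therefore changes by [hmin + hmax], and
    the segment is a factor when the bottom edge has lattice length at least
    [- hmin] and there are no other vertices at negative heights.  So a Fano
    polygon with such an edge is not minimal when [hmax < - hmin].  It remains
    to find one whose dual has barycentre zero.

    If the diagonals of a quadrilateral with vertices [u1], ..., [u4] meet in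
    [o], its barycentre is [(u1 + u2 + u3 + u4 - o) / 3].  Up to linear maps,
    the quadrilaterals with barycentre zero thus form a family with two
    parameters, the ratios in which [o] divides the two diagonals.  The ratios
    [2 : 5] and [5 : 7] give a polygon [P] whose vertices are primitive in the
    lattice that they generate; refining this lattice with index five in the
    direction of one edge makes that edge longer than its distance to the
    origin, and the vertices stay primitive.  The result is the polygon with vertices

      (-57, -74), (63, -74), (116, 37), (-106, 73),

    for which [w] is the second coordinate, [hmin = -74], [hmax = 73] and the
    bottom edge has length 120.  It has 176 boundary lattice points and its
    mutation has 175.

    Two tools make this checkable.  [hull_halfplanes] says that a cyclic list of
    lattice points which passes a finite test on cross products spans the
    intersection of the half-planes on the left of its edges; with it,
    membership in either polygon becomes a list of linear inequalities
    ([ke_polygonP], [mutated_polygonP]), and boundary lattice points can be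
    enumerated ([on_boundary_list]).  For the barycentre, [real_points_dual]
    identifies the closure of the rational dual polygon with the real dual
    polygon; that is the region between two piecewise affine functions, whose
    moments Fubini's theorem turns into integrals of piecewise quadratic
    functions of one variable ([region_moments]). *)

Set Implicit Arguments.
Unset Strict Implicit.
Unset Printing Implicit Defensive.

Import Order.TTheory GRing.Theory Num.Theory numFieldNormedType.Exports.
Local Open Scope classical_set_scope.
Local Open Scope ring_scope.

(** * Convex hulls in the rational plane *)

(** Convexity in terms of coefficients in the field, without the type of
    elements of the unit interval. *)
Lemma convex_setP (A : set rplane) :
  (forall x y (t : rat), A x -> A y -> 0 <= t <= 1 -> A (t *: x + (1 - t) *: y)) <->
  @convex_set rat rplane A.
Proof.
split=> [cA x y t /set_mem Ax /set_mem Ay|cA x y t Ax Ay t01].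
  by apply/mem_set/cA => //; rewrite ge0 le1.
have /set_mem := cA x y (@Itv01 rat t (andP t01).1 (andP t01).2) (mem_set Ax) (mem_set Ay).
by [].
Qed.

Lemma conv_hull_convex (A : set rplane) x y (t : rat) :
  conv_hull A x -> conv_hull A y -> 0 <= t <= 1 ->
  conv_hull A (t *: x + (1 - t) *: y).
Proof.
move=> hx hy t01 B [cB AB].
by move/convex_setP: (cB); apply=> //; [apply: hx | apply: hy].
Qed.

Lemma sub_conv_hull (A : set rplane) : A `<=` conv_hull A.
Proof. exact: sub_gen_smallest. Qed.

Lemma conv_hull_min (A B : set rplane) :
  (forall x y (t : rat), B x -> B y -> 0 <= t <= 1 -> B (t *: x + (1 - t) *: y)) ->
  A `<=` B -> conv_hull A `<=` B.
Proof. by move=> /convex_setP cB AB; apply: smallest_sub. Qed.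

Lemma conv_hull_set0 : conv_hull set0 = set0.
Proof. by apply/seteqP; split=> //; apply: conv_hull_min. Qed.

(** If an extreme point [v] were not in [A], removing it from the hull would
    leave a smaller convex set that still contains [A]. *)
Lemma vertices_conv_hull (A : set rplane) : vertices (conv_hull A) `<=` A.
Proof.
move=> v [hv ext]; apply: contrapT => nAv.
suff: (conv_hull A `\ v) v by case=> _; apply.
have : conv_hull A `<=` conv_hull A `\ v; last exact.
apply: conv_hull_min => [x y t [hx xv] [hy yv] /andP[t0 t1]|x Ax]; last first.
  by split; [exact: sub_conv_hull|move=> /= xv; rewrite xv in Ax].
split; first by apply: conv_hull_convex => //; rewrite t0.
move=> /= e.
have [t0'|tn0] := eqVneq t 0.
  by move: e; rewrite t0' scale0r add0r subr0 scale1r.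
have [t1'|tn1] := eqVneq t 1.
  by move: e; rewrite t1' subrr scale0r addr0 scale1r.
have [] := ext x y t hx hy _ _ (esym e); rewrite ?lt_neqAle ?t0 ?t1 ?tn1 ?andbT//.
by rewrite eq_sym.
Qed.

Lemma conv_hull3 (A : set rplane) (x y z : rplane) (a b : rat) :
  conv_hull A x -> conv_hull A y -> conv_hull A z -> 0 <= a -> 0 <= b -> a + b <= 1 ->
  conv_hull A (a *: x + b *: y + (1 - (a + b)) *: z).
Proof.
move=> hx hy hz a0 b0 ab1.
have [ab0|abn0] := eqVneq (a + b) 0.
  have [-> ->] : a = 0 /\ b = 0 by split; lra.
  by rewrite !scale0r !add0r subr0 scale1r.
have abp : 0 < a + b by rewrite lt_neqAle eq_sym abn0; lra.
have -> : a *: x + b *: y + (1 - (a + b)) *: z =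
   (a + b) *: (a / (a + b) *: x + (1 - a / (a + b)) *: y) + (1 - (a + b)) *: z.
  rewrite scalerDr !scalerA; congr (_ *: _ + _ *: _ + _); field => //.
apply: conv_hull_convex => //; last by rewrite ab1 ltW.
apply: conv_hull_convex => //; rewrite divr_ge0 ?(ltW abp)//= ler_pdivrMr// mul1r; lra.
Qed.

(** * Convex polygons as intersections of half-planes *)

Section Cross.
Variable K : comPzRingType.
Implicit Types a b p : K * K.

Definition cross a b : K := a.1 * b.2 - a.2 * b.1.

(** Twice the signed area of the triangle [a], [b], [p]: it is nonnegative when
    [p] lies on the left of the line from [a] to [b] or on it. *)
Definition orient a b p : K := cross a b + cross b p + cross p a.

End Cross.

Lemma cross_of_latt (a b : latt) :
  cross (of_latt a) (of_latt b) = (cross a b)%:~R :> rat.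
Proof. by rewrite /cross /= rmorphB !rmorphM. Qed.

Lemma orient_of_latt (a b c : latt) :
  orient (of_latt a) (of_latt b) (of_latt c) = (orient a b c)%:~R :> rat.
Proof. by rewrite /orient !cross_of_latt !rmorphD. Qed.

(** In an open half-plane, comparing vectors by angle is a transitive
    relation. *)
Lemma cross_trans (K : realDomainType) (p a b c : K * K) :
  0 < cross a p -> 0 < cross b p -> 0 < cross c p ->
  0 < cross a b -> 0 < cross b c -> 0 < cross a c.
Proof.
move=> ap bp cp ab bc; rewrite -(pmulr_lgt0 _ bp).
have -> : cross a c * cross b p = cross a b * cross c p + cross b c * cross a p.
  by rewrite /cross; ring.
by rewrite addr_gt0// mulr_gt0.
Qed.

Lemma orient_convex (v w x y : rplane) (t : rat) :
  orient (v : rat * rat) w (t *: x + (1 - t) *: y) =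
  t * orient (v : rat * rat) w x + (1 - t) * orient (v : rat * rat) w y.
Proof. by rewrite /orient /cross /=; rewrite /GRing.scale /=; ring. Qed.

(** A test, decided by computation, for a cyclic list to enumerate
    counterclockwise the vertices of a strictly convex polygon around the
    origin. *)
Definition convex_polygon (s : seq latt) : bool :=
  [&& s != [::], uniq s &
    cycle (fun v w => (0 < cross v w) &&
             all (fun z => (z \in [:: v; w]) || (0 < orient v w z)) s) s].

Definition edge_side (s : seq latt) (v : latt) (p : rplane) : rat :=
  orient (of_latt v : rat * rat) (of_latt (next s v)) p.

Definition halfplanes (s : seq latt) : set rplane :=
  [set p | forall v, v \in s -> 0 <= edge_side s v p].

Definition hull (s : seq latt) : set rplane :=
  conv_hull [set of_latt z | z in [set` s]].

Lemma sub_hull s v : v \in s -> hull s (of_latt v).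
Proof. by move=> vs; apply: sub_conv_hull; exists v. Qed.

Lemma hull_nil : hull [::] = set0.
Proof.
rewrite /hull (_ : image _ _ = set0) ?conv_hull_set0//.
by apply/seteqP; split=> // x [z]; rewrite /= in_nil.
Qed.

Lemma hull_segment (a b y : int) (p : rplane) : a < b ->
  hull [:: (a, y); (b, y)] p <-> p.2 = y%:~R /\ a%:~R <= p.1 <= b%:~R.
Proof.
move=> ab; split=> [|[py /andP[ap pb]]].
  move: p; apply: conv_hull_min => [x z t [x2 x1] [z2 z1] t01|_ [z zs <-]].
    rewrite /= /GRing.scale /= x2 z2; split; first ring.
    nra.
  by move: zs; rewrite /= !inE => /orP[]/eqP->; rewrite /= !ler_int !lexx ltW.
have ab' : a%:~R < b%:~R :> rat by rewrite ltr_int.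
have -> : p = ((b%:~R - p.1) / (b%:~R - a%:~R)) *: of_latt (a, y) +
      (1 - (b%:~R - p.1) / (b%:~R - a%:~R)) *: of_latt (b, y).
  case: p py ap pb => p1 p2 /= -> _ _; congr pair; rewrite /= /GRing.scale /=; last ring.
  field; rewrite subr_eq0 gt_eqF//.
apply: conv_hull_convex; try by apply: sub_hull; rewrite !inE eqxx ?orbT.
by rewrite divr_ge0 ?subr_ge0 ?(ltW ab')//= ler_pdivrMr ?subr_gt0// mul1r lerD2l lerN2.
Qed.

Lemma convex_polygon_edge s v : convex_polygon s -> v \in s ->
  [/\ next s v \in s, 0 < cross v (next s v) &
   forall z, z \in s -> z != v -> z != next s v -> 0 < orient v (next s v) z].
Proof.
move=> /and3P[_ us cs] vs; have /andP[c0 /allP h] := next_cycle cs vs.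
rewrite mem_next; split=> // z /h; rewrite !inE.
by move=> /orP[/orP[]/eqP->|//]; rewrite eqxx.
Qed.

Lemma orient_ge0 s v z : convex_polygon s -> v \in s -> z \in s ->
  0 <= orient v (next s v) z.
Proof.
move=> cs vs zs; have [_ _ h] := convex_polygon_edge cs vs.
have [->|zv] := eqVneq z v; first by rewrite /orient /cross; lia.
have [->|zw] := eqVneq z (next s v); first by rewrite /orient /cross; lia.
by rewrite ltW// h.
Qed.

(** The positive turns [0 < cross v w] alone prevent the vertices from lying in
    an open half-plane: there they would be ordered by angle, and going once
    around the cycle the first vertex would come strictly before itself. *)
Lemma not_in_halfplane s (p : rplane) : convex_polygon s ->
  ~ forall v, v \in s -> 0 < cross (of_latt v : rat * rat) p.
Proof.
case: s => [|v t]; first by case/and3P.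
move=> /and3P[_ _ /= cs] h.
set e := (X in path X _ _) in cs.
pose r (v w : latt) : bool := 0 < cross v w.
have rt : {in [pred z : latt | 0 < cross (of_latt z : rat * rat) p] & &, transitive r}.
  move=> y x z; rewrite !inE => hy hx hz; rewrite /r => xy yz.
  have := @cross_trans rat p (of_latt x) (of_latt y) (of_latt z) hx hy hz.
  by rewrite !cross_of_latt !ltr0z; apply.
have rp : path r v (rcons t v) by apply: sub_path cs => x y /andP[].
have inP : all [pred z : latt | 0 < cross (of_latt z : rat * rat) p] (v :: rcons t v).
  by apply/allP => z; rewrite in_cons mem_rcons in_cons orbA orbb => zs; exact: h.
have := order_path_min_in rt inP rp; rewrite all_rcons => /andP[].
by rewrite /r /cross; lia.
Qed.

(** The cones spanned by consecutive vertices cover the plane.  Otherwise, as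
    soon as one vertex is on the nonnegative side of the line through [p], the
    next one is strictly on that side, and going around the cycle all of them
    are; if there is no such vertex, all are strictly on the other side. *)
Lemma cone_of_point s (p : rplane) : convex_polygon s ->
  exists2 v, v \in s & 0 <= cross (of_latt v : rat * rat) p /\
    0 <= cross (p : rat * rat) (of_latt (next s v)).
Proof.
move=> cs; apply: contrapT => nx.
pose f v := cross (of_latt v : rat * rat) p.
have fN v : cross (p : rat * rat) (of_latt v) = - f v by rewrite /f /cross; ring.
have step v : v \in s -> 0 <= f v -> 0 < f (next s v).
  move=> vs fv; rewrite ltNge; apply/negP => fw; apply: nx.
  by exists v; rewrite // fN oppr_ge0.
have [us sp] : uniq s /\ cycle (frel (next s)) s.
  by have /and3P[_ us _] := cs; split=> //; exact: cycle_next.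
have [/hasP[v vs fv]|/hasPn neg] := boolP (has (fun v => 0 <= f v) s).
  have ge0 w : w \in s -> 0 <= f w.
    have [i t st] := rot_to vs; rewrite -(mem_rot i) st.
    have : fpath (next s) v t.
      have : cycle (frel (next s)) (rot i s) by rewrite rot_cycle.
      by rewrite st /= rcons_path => /andP[].
    elim: t v vs fv {st} => [|y t IH] v vs fv /=; first by rewrite mem_seq1 => _ /eqP->.
    move=> /andP[/eqP <- pt]; rewrite in_cons => /orP[/eqP-> //|].
    by apply: IH; rewrite ?mem_next// ltW// step.
  apply: (@not_in_halfplane s p cs) => w ws.
  by rewrite -(next_prev us w); apply/step/ge0; rewrite ?mem_prev.
apply: (@not_in_halfplane s (- p) cs) => w /neg; rewrite -ltNge => fw.
have -> : cross (of_latt w : rat * rat) (- p) = - f w by rewrite /f /cross /=; ring.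
by rewrite oppr_gt0.
Qed.

Lemma cone_combination (K : fieldType) (v w p : K * K) : cross v w != 0 ->
  p = (cross p w / cross v w * v.1 + cross v p / cross v w * w.1,
       cross p w / cross v w * v.2 + cross v p / cross v w * w.2).
Proof. by case: p => x y; rewrite /cross => /= nz; congr pair; field. Qed.

Lemma cone_ge0 (v w : latt) (p : rplane) : 0 < cross v w ->
  0 <= cross (of_latt v : rat * rat) p -> 0 <= cross (p : rat * rat) (of_latt w) ->
  exists a b : rat, [/\ 0 <= a, 0 <= b, p = a *: of_latt v + b *: of_latt w &
    orient (of_latt v : rat * rat) (of_latt w) p = (1 - (a + b)) * (cross v w)%:~R].
Proof.
move=> c0 vp pw; have c0' : 0 < (cross v w)%:~R :> rat by rewrite ltr0z.
exists (cross (p : rat * rat) (of_latt w) / (cross v w)%:~R).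
exists (cross (of_latt v : rat * rat) p / (cross v w)%:~R).
split; rewrite ?divr_ge0// ?(ltW c0')//.
  rewrite -cross_of_latt; apply: cone_combination.
  by rewrite cross_of_latt gt_eqF.
rewrite -mulrDl mulrBl mul1r divfK ?gt_eqF// /orient cross_of_latt /cross; ring.
Qed.

(** The point opposite to a vertex lies in a cone over an edge; this writes
    the origin as a convex combination of three vertices. *)
Lemma hull0 s : convex_polygon s -> hull s 0.
Proof.
move=> cs; have /and3P[s0 _ _] := cs.
have [v vs] : exists v, v \in s by case: (s) s0 => // v t _; exists v; rewrite mem_head.
have [w ws [h1 h2]] := cone_of_point (- of_latt v) cs.
have [ns c0 _] := convex_polygon_edge cs ws.
have [a [b [a0 b0 e _]]] := cone_ge0 c0 h1 h2.
have d0 : 0 < 1 + a + b by lra.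
have -> : 0 = (a / (1 + a + b)) *: of_latt w + (b / (1 + a + b)) *: of_latt (next s w)
  + (1 - (a / (1 + a + b) + b / (1 + a + b))) *: of_latt v :> rplane.
  have -> : 1 - (a / (1 + a + b) + b / (1 + a + b)) = (1 + a + b)^-1.
    by field; rewrite gt_eqF.
  by rewrite ![_ / _]mulrC -!scalerA -!scalerDr -e addNr scaler0.
apply: conv_hull3; rewrite ?divr_ge0 ?(ltW d0)//; do ?exact: sub_hull.
by rewrite -mulrDl ler_pdivrMr// mul1r; lra.
Qed.

(** A point of the intersection lies in a cone over an edge, hence is a
    nonnegative combination of the end points of that edge, and the inequality of
    the edge says that the coefficients add up to at most one. *)
Theorem hull_halfplanes s : convex_polygon s -> hull s = halfplanes s.
Proof.
move=> cs; apply/seteqP; split=> [|p hp].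
  apply: conv_hull_min => [x y t hx hy /andP[t0 t1] v vs|_ [z zs <-] v vs].
    rewrite /edge_side orient_convex.
    by rewrite addr_ge0// mulr_ge0 ?subr_ge0//; [exact: hx | exact: hy].
  by rewrite /edge_side orient_of_latt ler0z orient_ge0.
have [v vs [h1 h2]] := cone_of_point p cs.
have [ns c0 _] := convex_polygon_edge cs vs.
have [a [b [a0 b0 e o]]] := cone_ge0 c0 h1 h2.
have -> : p = a *: of_latt v + b *: of_latt (next s v) + (1 - (a + b)) *: 0.
  by rewrite scaler0 addr0.
apply: conv_hull3 => //; [exact: sub_hull..|exact: hull0|].
by have := hp v vs; rewrite /edge_side o pmulr_lge0 ?ltr0z// subr_ge0.
Qed.

(** * Boundary lattice points *)

Lemma filter_all_seq (T : Type) (I : eqType) (F : set_system T) (s : seq I) (A : I -> set T) :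
  Filter F -> (forall i, i \in s -> F (A i)) -> F [set x | forall i, i \in s -> A i x].
Proof.
move=> FF; elim: s => [|i s IH] As; first exact: filterE.
have FA : F [set x | forall j, j \in s -> A j x].
  by apply: IH => j js; apply: As; rewrite in_cons js orbT.
apply: filterS2 (As i (mem_head i s)) FA => x xi xs j.
by rewrite in_cons => /orP[/eqP->|/xs].
Qed.

Lemma edge_side_continuous s v : continuous (edge_side s v : rplane -> rat^o).
Proof.
have -> : (edge_side s v : rplane -> rat^o) = fun q : rplane =>
    cross (of_latt v : rat * rat) (of_latt (next s v)) +
    ((of_latt (next s v)).1 - (of_latt v).1) * q.2 +
    ((of_latt v).2 - (of_latt (next s v)).2) * q.1.
  by apply/funext => q; rewrite /edge_side /orient /cross /=; ring.
move=> q; apply: cvgD; [apply: cvgD; [exact: cvg_cst|]|];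
  by apply: cvgM; [exact: cvg_cst|first [exact: cvg_snd|exact: cvg_fst]].
Qed.

Lemma halfplanes_interior s p :
  (forall v, v \in s -> 0 < edge_side s v p) -> interior (halfplanes s) p.
Proof.
move=> sp; apply: filter_all_seq => v vs.
exact: (cvgr_ge _ (@edge_side_continuous s v p) _ (sp v vs)).
Qed.

Lemma halfplanes_closed s : closure (halfplanes s) `<=` halfplanes s.
Proof.
move=> p cp v vs; rewrite leNgt; apply/negP => pv.
have : nbhs p [set q | edge_side s v q < 0].
  exact: (cvgr_lt _ (@edge_side_continuous s v p) _ pv).
by move=> /cp[q [/(_ v vs) + /= ]]; rewrite leNgt => /negbTE->.
Qed.

Lemma edge_side_scale s v (p : rplane) (t : rat) :
  edge_side s v (t *: p) = t * edge_side s v p + (1 - t) * (cross v (next s v))%:~R.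
Proof. by rewrite /edge_side -cross_of_latt /orient /cross /= /GRing.scale /=; ring. Qed.

Definition on_boundary s (z : latt) : bool :=
  all (fun v => 0 <= orient v (next s v) z) s &&
  has (fun v => orient v (next s v) z == 0) s.

(** A point on an edge is not interior: dilating it slightly from the origin
    crosses the line of that edge. *)
Lemma boundary_pointsE s : convex_polygon s ->
  boundary_points (hull s) = [set z | on_boundary s z].
Proof.
move=> cs; rewrite /boundary_points hull_halfplanes//.
have sideE v z : edge_side s v (of_latt z) = (orient v (next s v) z)%:~R.
  by rewrite /edge_side orient_of_latt.
apply/seteqP; split=> z /= => [[/halfplanes_closed hz nz]|/andP[/allP hz /hasP[v vs /eqP vz]]].
  apply/andP; split; first by apply/allP => v /hz; rewrite sideE ler0z.
  apply/negPn/negP => /hasPn nv; apply: nz; apply: halfplanes_interior => v vs.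
  rewrite lt_neqAle hz// andbT eq_sym sideE intr_eq0; exact: nv.
split; first by apply: subset_closure => v' /hz; rewrite sideE ler0z.
have [_ c0 _] := convex_polygon_edge cs vs.
move=> zi; have : \forall t \near (1 : rat^o), halfplanes s (t *: of_latt z).
  have : (fun t : rat^o => t *: of_latt z) @ (1 : rat^o) --> (1 : rat^o) *: of_latt z.
    exact: (@scalel_continuous _ _ (of_latt z)).
  by apply; rewrite scale1r.
move=> /nbhs_ballP[e /= e0 /(_ (1 + e / 2))].
have : ball (1 : rat^o) e (1 + e / 2).
  by rewrite -ball_normE /= opprD addrA subrr add0r normrN gtr0_norm; lra.
move=> /[swap]/[apply]/(_ v vs); rewrite edge_side_scale sideE vz mulr0 add0r.
have : 0 < (cross v (next s v))%:~R :> rat by rewrite ltr0z.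
move=> c1; rewrite pmulr_lge0// => h.
by suff : e <= 0; [rewrite leNgt e0|lra].
Qed.

(** The end point [w] is left out, since it opens the next edge. *)
Definition edge_points (v w : latt) : seq latt :=
  let m := gcdz (w.1 - v.1) (w.2 - v.2) in
  [seq (v.1 + j%:Z * ((w.1 - v.1) %/ m)%Z, v.2 + j%:Z * ((w.2 - v.2) %/ m)%Z)
    | j <- iota 0 `|m|%N].

Definition boundary_list s : seq latt :=
  flatten [seq edge_points v (next s v) | v <- s].

Lemma parallel_primitive (a b x y m : int) : m != 0 -> gcdz (m * a) (m * b) = m ->
  (m * a) * y = (m * b) * x -> exists j, x = j * a /\ y = j * b.
Proof.
move=> m0 gm e; have [p [q pq]] := Bezoutz (m * a) (m * b).
have e' : a * y = b * x by apply: (mulfI m0); rewrite !mulrA.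
have pq1 : p * a + q * b = 1.
  by apply: (mulfI m0); rewrite mulr1 -[RHS]gm -pq; ring.
exists (p * x + q * y); split.
  by rewrite -[LHS]mul1r -pq1 mulrDl -[q * b * x]mulrA -e'; ring.
by rewrite -[LHS]mul1r -pq1 mulrDl -[p * a * y]mulrA e'; ring.
Qed.

(** A lattice point on the line of the edge from [v] to [w] is [v + j *: d]
    with [d] the primitive direction; the previous edge forces [0 <= j] and the
    next one bounds [j] by the lattice length. *)
Lemma on_boundary_list s z : convex_polygon s ->
  on_boundary s z -> z \in boundary_list s.
Proof.
move=> cs /andP[/allP hz /hasP[v vs /eqP vz]].
have /and3P[_ us _] := cs.
pose u := prev s v; pose w := next s v; pose n := next s w.
have uv : next s u = v by rewrite next_prev.
have u_s : u \in s by rewrite mem_prev.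
have w_s : w \in s by rewrite mem_next.
have [_ cuv ouv] := convex_polygon_edge cs u_s; rewrite uv in cuv ouv.
have [_ cvw _] := convex_polygon_edge cs vs; rewrite -/w in cvw.
have [n_s cwn own] := convex_polygon_edge cs w_s; rewrite -/n in n_s cwn own.
have neq (a b : latt) : 0 < cross a b -> a != b.
  by move=> ab; apply/eqP => eab; move: ab; rewrite eab /cross; lia.
have nuw : w != u by apply/eqP => wu; move: cuv cvw; rewrite wu /cross; lia.
have nvn : v != n by apply/eqP => wu; move: cwn cvw; rewrite -wu /cross; lia.
have := ouv w w_s nuw; rewrite eq_sym neq// => /(_ isT) ouvw.
have := own v vs; rewrite neq// nvn => /(_ isT isT) ownv.
have := hz u u_s; rewrite uv => ouvz.
have := hz w w_s; rewrite -/n => ownz.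
move: vz; rewrite -/w => vz.
have [m [m0 gm [a wa] [b wb]]] : exists m : int, [/\ 0 < m,
   gcdz (w.1 - v.1) (w.2 - v.2) = m, exists a, w.1 - v.1 = m * a & exists b, w.2 - v.2 = m * b].
  exists (gcdz (w.1 - v.1) (w.2 - v.2)); split=> //.
  - rewrite lt_neqAle andbT eq_sym gcdz_eq0.
    apply/negP => /andP[]; rewrite !subr_eq0 => /eqP h1 /eqP h2.
    by move: cvw; rewrite /cross h1 h2 mulrC subrr.
  - by have /dvdzP[a e] := dvdz_gcdl (w.1 - v.1) (w.2 - v.2); exists a; rewrite mulrC.
  - by have /dvdzP[a e] := dvdz_gcdr (w.1 - v.1) (w.2 - v.2); exists a; rewrite mulrC.
have m0' : m != 0 by rewrite gt_eqF.
have [j [za zb]] : exists j, z.1 - v.1 = j * a /\ z.2 - v.2 = j * b.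
  apply: (parallel_primitive m0'); first by rewrite -wa -wb.
  by rewrite -wa -wb; apply/eqP; rewrite -subr_eq0 -vz; apply/eqP; rewrite /orient /cross; ring.
have w1 : w.1 = v.1 + m * a by lia.
have w2 : w.2 = v.2 + m * b by lia.
have z1 : z.1 = v.1 + j * a by lia.
have z2 : z.2 = v.2 + j * b by lia.
have j0 : 0 <= j.
  pose k := (v.1 - u.1) * b - (v.2 - u.2) * a.
  have e1 : orient u v w = m * k by rewrite /orient /cross w1 w2 /k; ring.
  have e2 : orient u v z = j * k by rewrite /orient /cross z1 z2 /k; ring.
  by move: ouvw ouvz; rewrite e1 e2 pmulr_rgt0// => k0; rewrite pmulr_lge0.
have jm : j <= m.
  pose k := (n.1 - w.1) * b - (n.2 - w.2) * a.
  have e1 : orient w n v = m * - k by rewrite /orient /cross /k w1 w2; ring.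
  have e2 : orient w n z = (m - j) * - k by rewrite /orient /cross z1 z2 /k w1 w2; ring.
  by move: ownv ownz; rewrite e1 e2 pmulr_rgt0// => k0; rewrite pmulr_lge0// subr_ge0.
have vE (x : latt) : x = (x.1, x.2) by case: x.
move: jm; rewrite le_eqVlt => /orP[/eqP jm|jm]; last first.
  apply/flatten_mapP; exists v => //; rewrite -/w /edge_points gm.
  apply/mapP; exists `|j|%N; first by rewrite mem_iota; lia.
  by rewrite wa wb !mulKz// gez0_abs// [LHS]vE z1 z2.
apply/flatten_mapP; exists w => //; apply/mapP; exists 0%N.
  rewrite mem_iota leqnn add0n absz_gt0 gcdz_eq0.
  apply/negP => /andP[]; rewrite !subr_eq0 => /eqP h1 /eqP h2.
  by move: cwn; rewrite /cross h1 h2 mulrC subrr.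
by rewrite !mul0r !addr0 [LHS]vE z1 z2 w1 w2 jm.
Qed.

Lemma card_le_seq (T : choiceType) (l : seq T) (A : set T) :
  A `<=` [set` l] -> (A #<= `I_(size l))%card.
Proof.
case: l => [|x0 l] Al.
  by rewrite (_ : A = set0) ?card_ge0//; apply/seteqP; split=> // x /Al; rewrite /= in_nil.
apply: (@card_le_trans _ _ _ (nth x0 (x0 :: l) @` `I_(size (x0 :: l)))).
  apply: subset_card_le => x /Al xl.
  by exists (index x (x0 :: l)); [move: xl; rewrite /mkset -index_mem | exact: nth_index].
exact: card_image_le.
Qed.

Lemma card_ge_seq (T : choiceType) (l : seq T) (A : set T) :
  uniq l -> [set` l] `<=` A -> (`I_(size l) #<= A)%card.
Proof.
case: l => [|x0 l] ul lA; first by rewrite (_ : `I_0 = set0) ?card_ge0// II0.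
have : (nth x0 (x0 :: l) @` `I_(size (x0 :: l)) #= `I_(size (x0 :: l)))%card.
  apply: inj_card_eq => i j /set_mem/= il /set_mem/= jl /eqP.
  by rewrite nth_uniq// => /eqP.
rewrite card_eq_le => /andP[_ /card_le_trans]; apply.
apply: subset_card_le => _ [i /= il <-].
by apply: lA; rewrite /= mem_nth.
Qed.

(** * Fano polygons and heights *)

Lemma of_latt_inj : injective of_latt.
Proof. by move=> [a b] [c d] [/intr_inj -> /intr_inj ->]. Qed.

Lemma fano_hull s : convex_polygon s -> all primitive s -> fano (hull s).
Proof.
move=> cs /allP prs; split; first by exists s.
- rewrite hull_halfplanes//; apply: halfplanes_interior => v vs.
  have [_ c0 _] := convex_polygon_edge cs vs.
  have -> : edge_side s v 0 = (cross v (next s v))%:~R.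
    by rewrite /edge_side -cross_of_latt /orient /cross /=; ring.
  by rewrite ltr0z.
- by move=> z /vertices_conv_hull[w ws /of_latt_inj <-]; exact: prs.
Qed.

Lemma hminE (w : latt) (P : set rplane) (h : int) (x : rplane) :
  P x -> height w x = h%:~R -> (forall y, P y -> h%:~R <= height w y) -> hmin w P = h.
Proof.
move=> Px xh minh; apply: xget_unique; first by split=> //; exists x.
move=> k [[y Py yk] mink]; apply/eqP; rewrite eq_le.
by rewrite -!(ler_int rat) -{1}xh mink//= -yk minh.
Qed.

Lemma hmaxE (w : latt) (P : set rplane) (h : int) (x : rplane) :
  P x -> height w x = h%:~R -> (forall y, P y -> height w y <= h%:~R) -> hmax w P = h.
Proof.
move=> Px xh maxh; apply: xget_unique; first by split=> //; exists x.
move=> k [[y Py yk] maxk]; apply/eqP; rewrite eq_le.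
by rewrite -!(ler_int rat) -{1}yk maxh//= -xh maxk.
Qed.

(** * The polygon and its mutation *)

Definition ke_vertices : seq latt := [:: (-57, -74); (63, -74); (116, 37); (-106, 73)].

(** The bottom edge of length 120 is cut down by 74, the vertex at height 37
    moves right by 37, and the vertex at height 73 becomes an edge of length 73. *)
Definition mutated_vertices : seq latt :=
  [:: (-57, -74); (-11, -74); (153, 37); (-33, 73); (-106, 73)].

Definition ke_polygon : set rplane := hull ke_vertices.

Definition mutated_polygon : set rplane := hull mutated_vertices.

Lemma ke_vertices_convex : convex_polygon ke_vertices. Proof. by vm_compute. Qed.

Lemma mutated_vertices_convex : convex_polygon mutated_vertices. Proof. by vm_compute. Qed.

Lemma ke_vertices_primitive : all primitive ke_vertices. Proof. by vm_compute. Qed.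

Lemma ke_boundary_list :
  [/\ uniq (boundary_list ke_vertices),
      all (on_boundary ke_vertices) (boundary_list ke_vertices) &
      size (boundary_list ke_vertices) = 176%N].
Proof. by split; vm_compute. Qed.

Lemma mutated_boundary_list : size (boundary_list mutated_vertices) = 175%N.
Proof. by vm_compute. Qed.

(** The constant of each edge is its lattice distance to the origin, that is the
    determinant of its end points divided by its lattice length. *)
Lemma ke_polygonP (p : rplane) : ke_polygon p <->
  [/\ - 74 <= p.2, 111 * p.1 - 53 * p.2 <= 37 * 295,
      6 * p.1 + 37 * p.2 <= 7 * 295 & - 245 <= 3 * p.1 + p.2 :> rat].
Proof.
rewrite /ke_polygon (hull_halfplanes ke_vertices_convex); split=> [hp|[h1 h2 h3 h4] v].
  split.
  - have := hp (-57, -74) isT. rewrite /edge_side /= /orient /cross /=. lra.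
  - have := hp (63, -74) isT. rewrite /edge_side /= /orient /cross /=. lra.
  - have := hp (116, 37) isT. rewrite /edge_side /= /orient /cross /=. lra.
  - have := hp (-106, 73) isT. rewrite /edge_side /= /orient /cross /=. lra.
rewrite !inE => /or4P[]/eqP->; rewrite /edge_side /= /orient /cross /=; lra.
Qed.

Lemma mutated_polygonP (p : rplane) : mutated_polygon p <->
  [/\ - 74 <= p.2, 111 * p.1 - 164 * p.2 <= 37 * 295,
      6 * p.1 + 31 * p.2 <= 7 * 295, p.2 <= 73 & - 245 <= 3 * p.1 + p.2 :> rat].
Proof.
rewrite /mutated_polygon (hull_halfplanes mutated_vertices_convex); split=> [hp|[h1 h2 h3 h4 h5] v].
  split.
  - have := hp (-57, -74) isT; rewrite /edge_side /= /orient /cross /=; lra.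
  - have := hp (-11, -74) isT; rewrite /edge_side /= /orient /cross /=; lra.
  - have := hp (153, 37) isT; rewrite /edge_side /= /orient /cross /=; lra.
  - have := hp (-33, 73) isT; rewrite /edge_side /= /orient /cross /=; lra.
  - have := hp (-106, 73) isT; rewrite /edge_side /= /orient /cross /=; lra.
by rewrite !inE => /orP[|/or4P[]]/eqP->; rewrite /edge_side /= /orient /cross /=; lra.
Qed.

Lemma mutation_loses_boundary_points :
  ~ (boundary_points ke_polygon #<= boundary_points mutated_polygon)%card.
Proof.
have [uP /allP bP zP] := ke_boundary_list.
move=> PQ; suff : (`I_176 #<= `I_175)%card by rewrite card_le_II.
rewrite -zP -mutated_boundary_list.
apply: card_le_trans (card_ge_seq uP _) (card_le_trans PQ (card_le_seq _)).
- by rewrite (boundary_pointsE ke_vertices_convex) => z /bP.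
- rewrite (boundary_pointsE mutated_vertices_convex) => z.
  exact: on_boundary_list mutated_vertices_convex.
Qed.

Lemma ke_polygon_fano : fano ke_polygon.
Proof. exact: fano_hull ke_vertices_convex ke_vertices_primitive. Qed.

Definition vertical : latt := (0, 1).

Definition unit_segment : set rplane := hull [:: (0, 0); (1, 0)].

(** The bottom edge is the sum of this segment and of 74 unit segments.  There
    are no vertices at heights between -73 and -1, so that the empty polytope is
    allowed there. *)
Definition remainder (h : int) : set rplane :=
  hull (if h == -74 then [:: (-57, -74); (-11, -74)] else [::]).

Lemma height_vertical p : height vertical p = p.2.
Proof. by rewrite /height /pairing /= mul0r add0r mul1r. Qed.

Lemma level_vertical h p : level vertical h p -> p.2 = h%:~R.
Proof. by move=> [z /= zh <-]; rewrite -zh height_vertical. Qed.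

Lemma slice_sub h p : slice vertical ke_polygon h p -> ke_polygon p /\ p.2 = h%:~R.
Proof.
move: p; apply: conv_hull_min => [x y t [Px xh] [Py yh] t01|p [Pp /level_vertical]//].
split; first exact: conv_hull_convex.
by rewrite /= xh yh /GRing.scale /=; ring.
Qed.

Lemma vertex_slice h v : v \in ke_vertices -> v.2 = h -> slice vertical ke_polygon h (of_latt v).
Proof.
move=> vs vh; apply: sub_conv_hull; split; first exact: sub_hull.
by exists v; rewrite //= height_vertical /= vh.
Qed.

Lemma hmin_ke_polygon : hmin vertical ke_polygon = -74.
Proof.
have h1 : (-57, -74) \in ke_vertices by [].
apply: (hminE (sub_hull h1)); first by rewrite height_vertical.
by move=> y /ke_polygonP[h _ _ _]; rewrite height_vertical; lra.
Qed.

Lemma hmax_ke_polygon : hmax vertical ke_polygon = 73.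
Proof.
have h1 : (-106, 73) \in ke_vertices by [].
apply: (hmaxE (sub_hull h1)); first by rewrite height_vertical.
by move=> y /ke_polygonP[]; rewrite height_vertical; lra.
Qed.

Lemma unit_segmentP p : unit_segment p <-> p.2 = 0 /\ 0 <= p.1 <= 1.
Proof. exact: (@hull_segment 0 1 0 _ isT). Qed.

Lemma unit_segment0 : unit_segment 0.
Proof. by apply: (@sub_hull _ (0, 0)). Qed.

Lemma unit_segment1 : unit_segment (of_latt (1, 0)).
Proof. exact: sub_hull. Qed.

Lemma unit_segment_factor : factor_with vertical ke_polygon unit_segment remainder.
Proof.
split; first by exists [:: (0, 0); (1, 0)].
  apply/seteqP; split=> [_ [p /unit_segmentP[p2 _] <-]|_ ->]; rewrite ?height_vertical//.
  by exists 0; [exact: unit_segment0 | rewrite height_vertical].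
rewrite hmin_ke_polygon => h h1 h2; split.
- by exists (if h == -74 then [:: (-57, -74); (-11, -74)] else [::]).
- move=> _ [/vertices_conv_hull[z zs <-] /level_vertical zh].
  have {}zh : z.2 = h by apply: intr_inj zh.
  (* Of the four vertices, only the two at height -74 lie below the origin. *)
  move: zs; rewrite /= !inE => /or4P[]/eqP ze; rewrite ze /= in zh; rewrite -?zh// in h1 h2 *.
  + exists (of_latt z); rewrite ze; first by apply: sub_hull.
    exists 0; last by rewrite addr0.
    by exists 0; [exact: unit_segment0 | rewrite scaler0].
  + exists (of_latt (-11, -74)); first by apply: sub_hull.
    exists (of_latt (74, 0)); last by rewrite ze; congr pair => /=; ring.
    exists (of_latt (1, 0)); first exact: unit_segment1.
    by congr pair; rewrite /= /GRing.scale /=; ring.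
- rewrite /remainder; case: eqP => [->|_]; last by rewrite hull_nil => x [].
  move=> _ [r /(@hull_segment (-57) (-11) (-74) _ isT)[r2 r1] [_ [f /unit_segmentP[f2 f1] <-] <-]].
  have : hull [:: (-57, -74); (63, -74)] (r + (`|-74|%:~R : rat) *: f).
    have -> : `|-74|%R = 74 :> int by [].
    apply: (@hull_segment (-57) 63 (-74) _ isT).2.
    rewrite /= /GRing.scale /= r2 f2; split; first ring.
    lra.
  apply: conv_hull_min => [x y t|_ [z zs <-]]; first exact: conv_hull_convex.
  by apply: vertex_slice; move: zs; rewrite /= !inE => /orP[]/eqP->.
Qed.

Lemma mut_ke_polygon :
  mut vertical ke_polygon unit_segment remainder = mutated_polygon.
Proof.
set M := mut _ _ _ _; apply/seteqP; split.
  apply: conv_hull_min => [x y t|]; first exact: conv_hull_convex.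
  move=> p [[h _]|[h /= [h0 _] [q qh [_ [f fF <-] <-]]]].
    rewrite /remainder; case: eqP => _; last by rewrite hull_nil.
    move=> /(@hull_segment (-57) (-11) (-74) _ isT)[p2 p1].
    by apply/mutated_polygonP; split; lra.
  have [/ke_polygonP[q1 q2 q3 q4] {}qh] := slice_sub qh.
  have [f2 f1] := (unit_segmentP f).1 fF.
  (* The point q moves right by q.2 * f.1, and the inequalities of the mutated
     polygon are affine in this shift, which ranges between 0 and q.2. *)
  have hq : 0 <= h%:~R :> rat by rewrite ler0z.
  apply/mutated_polygonP; rewrite /= /GRing.scale /= f2 -qh in hq *.
  have : 0 <= q.2 * f.1 <= q.2 by nra.
  by move=> /andP[s0 s1]; split; lra.
apply: conv_hull_min => [x y t|_ [z zs <-]]; first exact: conv_hull_convex.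
have bottom v : v \in [:: (-57, -74); (-11, -74)] -> M (of_latt v).
  move=> vs; apply: sub_conv_hull; left.
  by exists (-74); [rewrite /= hmin_ke_polygon | exact: sub_hull].
have shifted (h : int) v (e : int) : 0 <= h <= 73 -> v \in ke_vertices ->
    v.2 = h -> e \in [:: 0; 1] -> M (of_latt (v.1 + h * e, h)).
  move=> /andP[h0 h1] vs vh ee; apply: sub_conv_hull; right.
  exists h; first by rewrite /= hmax_ke_polygon.
  exists (of_latt v); first exact: vertex_slice.
  exists (h%:~R *: of_latt (e, 0)).
    exists (of_latt (e, 0)) => //; apply: sub_hull.
    by move: ee; rewrite !inE => /orP[]/eqP->.
  by congr pair; rewrite /= /GRing.scale /= ?vh ?rmorphD ?rmorphM//= mulr0 addr0.
move: zs; rewrite /= !inE => /orP[/eqP->|/or4P[]/eqP->].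
- exact: bottom.
- exact: bottom.
- exact: (shifted 37 (116, 37) 1).
- exact: (shifted 73 (-106, 73) 1).
- exact: (shifted 73 (-106, 73) 0).
Qed.

Lemma ke_polygon_not_minimal : ~ minimal ke_polygon.
Proof.
move=> mP; apply: mutation_loses_boundary_points; apply: mP.
exists vertical, unit_segment, remainder; split=> //; first exact: unit_segment_factor.
by rewrite mut_ke_polygon.
Qed.

(** * Real points of the dual polygon *)

Lemma dual_hull s (u : rplane) :
  dual (hull s) u <-> forall v, v \in s -> -1 <= pairing u (of_latt v).
Proof.
split=> [du v vs|uv]; first exact: du (sub_hull vs).
move=> x; apply: (@conv_hull_min _ [set x | -1 <= pairing u x]).
  move=> {}x y t; rewrite /pairing /= /GRing.scale /= => hx hy /andP[t0 t1].
  nra.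
by move=> _ [z zs <-]; exact: uv.
Qed.

Section RealDual.
Variable R : realType.

Definition real_form (v : latt) (p : R * R) : R := p.1 * v.1%:~R + p.2 * v.2%:~R.

Definition real_dual (s : seq latt) : set (R * R) :=
  [set p | forall v, v \in s -> -1 <= real_form v p].

Lemma real_form_continuous v : continuous (real_form v : R * R -> R).
Proof.
move=> p; apply: cvgD; apply: cvgM;
  first [exact: cvg_fst|exact: cvg_snd|exact: cvg_cst].
Qed.

Lemma real_form_ratr v (u : rplane) :
  real_form v (ratr u.1, ratr u.2) = ratr (pairing u (of_latt v)).
Proof. by rewrite /real_form /pairing /= rmorphD !rmorphM /= !ratr_int. Qed.

Lemma rational_points_dense (p : R * R) (B : set (R * R)) : nbhs p B ->
  exists u : rplane, B (ratr u.1, ratr u.2).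
Proof.
case: p => x y [[B1 B2] /= [nB1 nB2] BB].
have rat_nbhs (z : R) (C : set R) : nbhs z C -> exists q : rat, C (ratr q).
  move=> nC; have [_ [[q _ <-] Cq]] : (range (@ratr R) `&` C^°) !=set0; last first.
    by exists q; exact: interior_subset Cq.
  rewrite setIC; apply: dense_rat; last exact: open_interior.
  by exists z.
have [q1 h1] := rat_nbhs _ _ nB1; have [q2 h2] := rat_nbhs _ _ nB2.
by exists (q1, q2); apply: BB.
Qed.

(** The real dual polygon is closed.  Conversely, scaling one of its points by a
    factor slightly below one makes all the inequalities strict, so that nearby
    rational points satisfy them too. *)
Theorem real_points_dual s : @real_points R (dual (hull s)) = real_dual s.
Proof.
apply/seteqP; split=> p.
  move=> cp v vs; rewrite leNgt; apply/negP => pv.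
  have : nbhs p [set q | real_form v q < -1].
    exact: (cvgr_lt _ (@real_form_continuous v p) _ pv).
  move=> /cp[_ [[u /dual_hull/(_ v vs) uv <-]]] /=; rewrite real_form_ratr.
  by rewrite ltNge -(rmorphN1 (@ratr R)) ler_rat uv.
move=> dp B nB.
have : \forall t \near (1 : R^o), B° (t *: (p : R^o * R^o)).
  have : (fun t : R^o => t *: (p : R^o * R^o)) @ (1 : R^o) --> (1 : R^o) *: (p : R^o * R^o).
    exact: (@scalel_continuous _ _ (p : R^o * R^o)).
  by apply; rewrite scale1r; exact: nbhs_interior.
move=> /nbhs_ballP near1.
have [e e0 eB] : exists2 e : R, 0 < e &
    ball (1 : R^o) e `<=` [set t | B° (t *: (p : R^o * R^o))] by exact: near1.
pose t : R := 1 - Num.min e 1 / 2.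
have t01 : 0 < t < 1 by apply/andP; split; rewrite /t; case: (leP e 1) => ?; lra.
have {}eB : B° (t *: (p : R^o * R^o)).
  apply: eB; rewrite -ball_normE /= /t opprB addrCA subrr addr0 gtr0_norm.
    by case: (leP e 1) => ?; lra.
  by case: (leP e 1) => ?; lra.
have formZ v : real_form v (t *: (p : R^o * R^o)) = t * real_form v p.
  by rewrite /real_form /= /GRing.scale /=; ring.
have [u [Bu uv]] : exists u : rplane, (B `&` [set q | forall v, v \in s -> -1 < real_form v q])
    (ratr u.1, ratr u.2).
  apply: (@rational_points_dense (t *: (p : R^o * R^o))); apply: filterI; first exact: eB.
  apply: filter_all_seq => v vs.
  have := cvgr_gt _ (@real_form_continuous v (t *: (p : R^o * R^o))); apply.
  rewrite formZ; have := dp v vs; nra.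
exists (ratr u.1, ratr u.2); split=> //; exists u => //.
apply/dual_hull => v /uv /=; rewrite real_form_ratr.
by rewrite -(rmorphN1 (@ratr R)) ltr_rat => /ltW.
Qed.

End RealDual.

(** * Moments of regions between two graphs *)

Section Moments.
Variable R : realType.
Notation leb := (@lebesgue_measure R).
Notation mR := (measurableTypeR R).
Notation leb2 := (leb \x leb)%E.

Lemma integral_deriv_poly (p : {poly R}) (a b : R) : a <= b ->
  (\int[leb]_(x in `[a, b]) (p^`().[x])%:E = (p.[b] - p.[a])%:E)%E.
Proof.
rewrite le_eqVlt => /predU1P[->|ab]; first by rewrite set_itv1 integral_set1 subrr.
rewrite (@continuous_FTC2 _ _ (fun x => p.[x])) ?EFinB//.
- by apply: continuous_subspaceT => x; exact: continuous_horner.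
- split=> [x _||]; first exact: derivable_horner.
  + by apply: cvg_at_right_filter; exact: continuous_horner.
  + by apply: cvg_at_left_filter; exact: continuous_horner.
- by move=> x _; rewrite derivE.
Qed.

Definition region (a b : R) (l u : R -> R) : set (R * R) :=
  [set p | a <= p.1 <= b /\ l p.1 <= p.2 <= u p.1].

Lemma measurable_region (a b : R) (l u : R -> R) :
  measurable_fun [set: mR] l -> measurable_fun [set: mR] u ->
  measurable (region a b l u : set (mR * mR)).
Proof.
move=> ml mu.
have m (f g : mR * mR -> R) : measurable_fun setT f -> measurable_fun setT g ->
    measurable [set p | f p <= g p].
  by move=> mf mg; rewrite -[X in measurable X]setTI; exact: measurable_fun_le.
have -> : region a b l u = ([set p | cst a p <= p.1] `&` [set p | p.1 <= cst b p])
    `&` ([set p | (l \o fst) p <= p.2] `&` [set p | p.2 <= (u \o fst) p]).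
  by apply/seteqP; split=> [p [/andP[? ?] /andP[? ?]]//|p [[/= ? ?] [? ?]]];
    split; apply/andP.
by apply: measurableI; apply: measurableI; apply: m => //; exact: measurableT_comp.
Qed.

(** Fubini's theorem, with the inner integral given in closed form; the bound
    [M] makes the region and the integrand bounded, hence integrable. *)
Lemma Rintegral_region (a b : R) (l u : R -> R) (M : R) (f : mR * mR -> R) (g : R -> R) :
  measurable_fun [set: mR] l -> measurable_fun [set: mR] u ->
  measurable_fun [set: mR * mR] f ->
  (forall p, region a b l u p -> `|f p| <= M) ->
  (forall x, a <= x <= b -> - M <= l x /\ u x <= M) ->
  (forall x, a <= x <= b ->
     (\int[leb]_(y in `[l x, u x]) (f (x, y))%:E = (g x)%:E)%E) ->
  \int[leb2]_(p in region a b l u) f p = \int[leb]_(x in `[a, b]) g x.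
Proof.
move=> ml mu mf fM luM fg; have mS := measurable_region a b ml mu.
set S := (region a b l u : set (mR * mR)) in mS fM *.
have Sfin : (leb2 S < +oo)%E.
  apply: (@le_lt_trans _ _ (leb2 (`[a, b]%classic `*` `[- M, M]%classic))).
    apply: le_measure; rewrite ?inE//; first exact: measurableX.
    move=> p [pab /andP[lp pu]]; have [lM uM] := luM p.1 pab.
    split=> /=; rewrite in_itv/=//.
    by rewrite (le_trans lM lp) (le_trans pu uM).
  have fin (c d : R) : (leb `[c, d] < +oo)%E.
    by rewrite lebesgue_measure_itv/=; case: ifP => _; rewrite ?ltry// -EFinB ltry.
  rewrite product_measure1E//; apply: lte_mul_pinfty; rewrite ?measure_ge0//.
    by rewrite ge0_fin_numE ?measure_ge0//; exact: fin.
  exact: fin.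
have fint : leb2.-integrable S (EFin \o f).
  apply: measurable_bounded_integrable => //.
  - exact: measurable_funTS.
  - exists M; split; first exact: num_real.
    move=> N MN p Sp; exact (le_trans (fM p Sp) (ltW MN)).
rewrite /Rintegral; congr fine.
have fint' : leb2.-integrable setT ((EFin \o f) \_ S).
  exact: ((integrable_mkcond (EFin \o f) mS).1 fint).
rewrite integral_mkcond -(integral12_prod_meas1 fint').
rewrite [RHS]integral_mkcond; apply: eq_integral => x _.
rewrite /fubini_F /patch; case: ifPn => [/set_mem|/negP xab].
  rewrite /= in_itv/= => xab.
  rewrite -fg// [RHS]integral_mkcond; apply: eq_integral => y _.
  rewrite /patch; congr (if _ then _ else _).
  apply/idP/idP => /set_mem h; apply/mem_set; first by case: h => _; rewrite /= in_itv.
  by split=> //; move: h; rewrite /= in_itv.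
apply: integral0_eq => y _; case: ifPn => // /set_mem[xab' _].
by case: xab; apply/mem_set; rewrite /= in_itv.
Qed.

Lemma region_moments (a b : R) (l u : R -> R) (M : R) :
  measurable_fun [set: mR] l -> measurable_fun [set: mR] u ->
  (forall x, a <= x <= b -> [/\ `|x| <= M, - M <= l x, l x <= u x & u x <= M]) ->
  \int[leb2]_(p in region a b l u) p.1 = \int[leb]_(x in `[a, b]) (x * (u x - l x)) /\
  \int[leb2]_(p in region a b l u) p.2 =
    \int[leb]_(x in `[a, b]) ((u x ^+ 2 - l x ^+ 2) / 2).
Proof.
move=> ml mu lu.
have luM x : a <= x <= b -> - M <= l x /\ u x <= M by move=> /lu[].
split.
- apply: (Rintegral_region (M := M) ml mu) => //.
  + by move=> p [/lu[]].
  + move=> x /lu[_ _ lux _].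
    transitivity (\int[leb]_(y in `[l x, u x]) ((x *: 'X : {poly R})^`().[y])%:E)%E.
      by apply: eq_integral => y _; rewrite derivZ derivX hornerZ hornerC mulr1.
    by rewrite integral_deriv_poly// !hornerZ !hornerX mulrBr.
- apply: (Rintegral_region (M := M) ml mu) => //.
  + move=> p [/lu[_ lM _ uM] /andP[lp pu]].
    by rewrite ler_norml (le_trans lM lp) (le_trans pu uM).
  + move=> x /lu[_ _ lux _].
    transitivity (\int[leb]_(y in `[l x, u x]) ((2^-1 *: 'X^2 : {poly R})^`().[y])%:E)%E.
      apply: eq_integral => y _; rewrite derivZ derivXn hornerZ hornerMn hornerXn /= expr1.
      by congr EFin; field.
    by rewrite integral_deriv_poly// !hornerZ !hornerXn -mulrBr mulrC.
Qed.

Lemma Rintegral_quadratic (g : R -> R) (a b c0 c1 c2 : R) : a <= b ->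
  (forall x, a <= x <= b -> g x = c0 + c1 * x + c2 * x ^+ 2) ->
  \int[leb]_(x in `[a, b]) g x =
    c0 * (b - a) + c1 / 2 * (b ^+ 2 - a ^+ 2) + c2 / 3 * (b ^+ 3 - a ^+ 3).
Proof.
move=> ab gE.
pose p : {poly R} := c0 *: 'X + (c1 / 2) *: 'X^2 + (c2 / 3) *: 'X^3.
have -> : \int[leb]_(x in `[a, b]) g x = fine (\int[leb]_(x in `[a, b]) (p^`().[x])%:E)%E.
  congr fine; apply: eq_integral => x /set_mem.
  rewrite /= in_itv/= => /gE ->; congr EFin.
  by rewrite /p !derivD !derivZ derivX !derivXn !hornerE /=; field.
by rewrite integral_deriv_poly//= /p !hornerD !hornerZ !hornerX !hornerXn; field.
Qed.

Lemma strip_moments (l u : R -> R) (a b p q r t : R) : a <= b ->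
  (forall x, a <= x <= b -> u x = p + q * x /\ l x = r + t * x) ->
  \int[leb]_(x in `[a, b]) (x * (u x - l x)) =
    (p - r) / 2 * (b ^+ 2 - a ^+ 2) + (q - t) / 3 * (b ^+ 3 - a ^+ 3) /\
  \int[leb]_(x in `[a, b]) ((u x ^+ 2 - l x ^+ 2) / 2) =
    (p ^+ 2 - r ^+ 2) / 2 * (b - a) + (p * q - r * t) / 2 * (b ^+ 2 - a ^+ 2) +
    (q ^+ 2 - t ^+ 2) / 6 * (b ^+ 3 - a ^+ 3).
Proof.
move=> ab luE; split.
- rewrite (@Rintegral_quadratic _ _ _ 0 (p - r) (q - t)) ?mul0r ?add0r//.
  by move=> x /luE[-> ->]; ring.
- rewrite (@Rintegral_quadratic _ _ _ ((p ^+ 2 - r ^+ 2) / 2) (p * q - r * t)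
    ((q ^+ 2 - t ^+ 2) / 2))//; first by field.
  by move=> x /luE[-> ->]; field.
Qed.

Lemma Rintegral_split (g : R -> R) (a b c : R) :
  continuous g -> a <= b -> b <= c ->
  \int[leb]_(x in `[a, c]) g x =
    \int[leb]_(x in `[a, b]) g x + \int[leb]_(x in `[b, c]) g x.
Proof.
move=> cg ab bc.
have gi (u v : R) : leb.-integrable `[u, v] (EFin \o g).
  apply: continuous_compact_integrable; first exact: segment_compact.
  exact: continuous_subspaceT.
rewrite -(@Rintegral_itv_obnd_cbnd _ b); last first.
  by apply: integrableS (gi b c) => //; apply: subset_itvr; rewrite bnd_simp.
by rewrite -(@Rintegral_itvB _ _ (BLeft a)) ?bnd_simp// addrC subrK.
Qed.

End Moments.

(** * The barycentre of the dual polygon *)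

Section Barycentre.
Variable R : realType.
Notation leb := (@lebesgue_measure R).
Notation mR := (measurableTypeR R).
Notation leb2 := (leb \x leb)%E.

(** The bottom two vertices of the polygon bound its dual from above. *)
Definition upper (x : R) : R := Num.min ((1 - 57 * x) / 74) ((1 + 63 * x) / 74).

Definition lower (x : R) : R := Num.max (- (1 + 116 * x) / 37) ((106 * x - 1) / 73).

Lemma affine_continuous (c d : R) : continuous (fun x : R => c + d * x).
Proof.
by move=> x; apply: cvgD; [exact: cvg_cst|apply: cvgM; [exact: cvg_cst|exact: cvg_id]].
Qed.

Lemma upper_continuous : continuous upper.
Proof.
rewrite (_ : upper = (fun x => 74^-1 + (- 57 / 74) * x) \min (fun x => 74^-1 + 63 / 74 * x)).
  by move=> x; apply: continuous_min; exact: affine_continuous.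
by apply/funext => x; rewrite /upper /=; congr Num.min; field.
Qed.

Lemma lower_continuous : continuous lower.
Proof.
rewrite (_ : lower = (fun x => - 37^-1 + (- 116 / 37) * x) \max
                     (fun x => - 73^-1 + 106 / 73 * x)).
  by move=> x; apply: continuous_max; exact: affine_continuous.
by apply/funext => x; rewrite /lower /=; congr Num.max; field.
Qed.

(** The abscissas -3/295 and 3/245 are those of the leftmost and rightmost
    vertices of the dual polygon, where [lower] and [upper] meet. *)
Lemma real_dual_region : @real_dual R ke_vertices = region (- 3 / 295) (3 / 245) lower upper.
Proof.
apply/seteqP; split=> p.
  move=> dp.
  have := dp (-57, -74) isT; have := dp (63, -74) isT.
  have := dp (116, 37) isT; have := dp (-106, 73) isT.
  rewrite /real_form /= => h1 h2 h3 h4.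
  split; apply/andP; split; try lra.
  - rewrite /lower ge_max; apply/andP; split; lra.
  - rewrite /upper le_min; apply/andP; split; lra.
move=> [_]; rewrite /lower /upper ge_max le_min => /andP[/andP[h1 h2] /andP[h3 h4]] v.
by rewrite !inE => /or4P[]/eqP->; rewrite /real_form /=; lra.
Qed.

Lemma upper_left x : x <= 0 -> upper x = (1 + 63 * x) / 74.
Proof. by move=> x0; rewrite /upper min_r//; lra. Qed.

Lemma upper_right x : 0 <= x -> upper x = (1 - 57 * x) / 74.
Proof. by move=> x0; rewrite /upper min_l//; lra. Qed.

Lemma lower_left x : x <= - 6 / (7 * 295) -> lower x = - (1 + 116 * x) / 37.
Proof. by move=> x0; rewrite /lower max_l//; lra. Qed.

Lemma lower_right x : - 6 / (7 * 295) <= x -> lower x = (106 * x - 1) / 73.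
Proof. by move=> x0; rewrite /lower max_r//; lra. Qed.

Lemma lower_le_upper x : - 3 / 295 <= x <= 3 / 245 ->
  [/\ - 1 <= lower x, lower x <= upper x & upper x <= 1].
Proof.
move=> /andP[x1 x2]; rewrite /lower /upper; split.
- by rewrite le_max; apply/orP; left; lra.
- by rewrite ge_max !le_min; apply/andP; split; apply/andP; split; lra.
- by rewrite ge_min; apply/orP; left; lra.
Qed.

(** The dual has its other two vertices at the abscissas -6/2065 and 0; between
    consecutive abscissas both moments have a quadratic integrand. *)
Lemma ke_polygon_kahler_einstein : kahler_einstein R ke_polygon.
Proof.
rewrite /kahler_einstein /ke_polygon real_points_dual real_dual_region /barycentre.
have ml : measurable_fun [set: mR] lower.
  exact: measurable_realfun.continuous_measurable_fun lower_continuous.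
have mu : measurable_fun [set: mR] upper.
  exact: measurable_realfun.continuous_measurable_fun upper_continuous.
have lu x : - 3 / 295 <= x <= 3 / 245 ->
    [/\ `|x| <= 1, - 1 <= lower x, lower x <= upper x & upper x <= 1].
  move=> xab; have [? ? ?] := lower_le_upper xab; split=> //.
  by rewrite ler_norml; move: xab => /andP[? ?]; apply/andP; split; lra.
have [-> ->] := region_moments ml mu lu.
have split3 (g : R -> R) : continuous g -> \int[leb]_(x in `[- 3 / 295, 3 / 245]) g x =
    \int[leb]_(x in `[- 3 / 295, - 6 / (7 * 295)]) g x +
    (\int[leb]_(x in `[- 6 / (7 * 295), 0]) g x + \int[leb]_(x in `[0, 3 / 245]) g x).
  by move=> cg; rewrite -!Rintegral_split//; lra.
have cl := lower_continuous; have cu := upper_continuous.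
rewrite !split3; last 2 first.
- move=> x; apply: cvgM; last exact: cvg_cst.
  by apply: cvgB; apply: cvgM; first [exact: cu|exact: cl].
- by move=> x; apply: cvgM; [exact: cvg_id|apply: cvgB; [exact: cu|exact: cl]].
have [e1 f1] := @strip_moments R lower upper (- 3 / 295) (- 6 / (7 * 295))
  (1 / 74) (63 / 74) (- 1 / 37) (- 116 / 37) ltac:(lra) ltac:(
  by move=> x /andP[? ?]; rewrite upper_left ?lower_left; [split; field|lra|lra]).
have [e2 f2] := @strip_moments R lower upper (- 6 / (7 * 295)) 0
  (1 / 74) (63 / 74) (- 1 / 73) (106 / 73) ltac:(lra) ltac:(
  by move=> x /andP[? ?]; rewrite upper_left ?lower_right; [split; field|lra|lra]).
have [e3 f3] := @strip_moments R lower upper 0 (3 / 245)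
  (1 / 74) (- 57 / 74) (- 1 / 73) (106 / 73) ltac:(lra) ltac:(
  by move=> x /andP[? ?]; rewrite upper_right ?lower_right; [split; field|lra|lra]).
rewrite e1 e2 e3 f1 f2 f3 {e1 e2 e3 f1 f2 f3}.
set area := fine _.
transitivity (0 / area, 0 / area); last by rewrite mul0r.
by congr (_ / _, _ / _); field.
Qed.

End Barycentre.

Theorem proposition1p6 (R : realType) :
  exists P : set rplane, [/\ fano P, kahler_einstein R P & ~ minimal P].
Proof.
exists ke_polygon; split.
- exact: ke_polygon_fano.
- exact: ke_polygon_kahler_einstein.
- exact: ke_polygon_not_minimal.
Qed.
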